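(* Let $N\ge 2$ be an integer, let $q$ be a primitive $N$th root of unity, and let $\mathscr{A}_q[x,y]$ be the algebra of polynomial functions on the reduced quantum plane, i.e. the associative unital $\mathbb{C}$-algebra generated by $x,y$ subject to the relations $x\,y=q\,y\,x$ and $x^N=y^N=\mathbb{1}$. Let $\mathscr{A}^0_q[x,y]$ be the subalgebra generated by $x$. Then $\mathscr{A}_q[x,y]$ is a semi-commutative Galois extension of $\mathscr{A}^0_q[x,y]$ by means of the element $y$.
   Context: Noncommutative Galois extension: let $\tilde{\mathscr{A}}$ be an associative unital $\mathbb{C}$-algebra with identity $\mathbb{1}$, $\mathscr{A}\subset\tilde{\mathscr{A}}$ a (unital) subalgebra, and $\tau\in\tilde{\mathscr{A}}$ an element such that, for an integer $N\ge2$, $\tau^N=\pm\mathbb{1}$ and $\tau^k\notin\mathscr{A}$ for every integer $1\le k\le N-1$. The smallest subalgebra $\mathscr{A}[\tau]\subset\tilde{\mathscr{A}}$ containing $\mathscr{A}$ and $\tau$ is called the noncommutative Galois extension of $\mathscr{A}$ by means of $\tau$. It is called a semi-commutative Galois extension if the left $\mathscr{A}$-module $\mathscr{A}\tau$ and the right $\mathscr{A}$-module $\tau\mathscr{A}$ generated by $\tau$ coincide. Here $\tilde{\mathscr{A}}=\mathscr{A}_q[x,y]$, $\mathscr{A}=\mathscr{A}^0_q[x,y]$ and $\tau=y$. *)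

(* Defs.v *)
From HB Require Import structures.
From mathcomp Require Import all_boot all_algebra.
From mathcomp Require Import generic_quotient ring_quotient.
From mathcomp Require Import boolp classical_sets finmap.
From mathcomp.multinomials Require Import monalg.

Set Implicit Arguments.
Unset Strict Implicit.
Unset Printing Implicit Defensive.

Import GRing.Theory.

Local Open Scope classical_set_scope.
Local Open Scope ring_scope.
Local Open Scope quotient_scope.

Section GaloisExtension.
Context {K : fieldType} {At : algType K}.
Implicit Types (A B G : set At) (tau : At).

(* [GRing.subalg_closed] includes the unit: subalgebras are unital. *)
Definition is_subalgebra A : Prop := GRing.subalg_closed [in A].

Definition subalgebra_gen G : set At := smallest is_subalgebra G.

Definition adjoin A tau : set At := subalgebra_gen (A `|` [set tau]).

Definition left_module A tau : set At := [set a * tau | a in A].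

Definition right_module A tau : set At := [set tau * a | a in A].

Record galois_generator (N : nat) A tau : Prop := GaloisGenerator {
  galois_sub : is_subalgebra A;
  galois_ge2 : (2 <= N)%N;
  galois_exp : tau ^+ N = 1 \/ tau ^+ N = - 1;
  galois_notin : forall k : nat, (1 <= k <= N - 1)%N -> ~ A (tau ^+ k)
}.

(* B is the noncommutative Galois extension of A by means of tau. *)
Definition galois_extension (N : nat) A tau B : Prop :=
  galois_generator N A tau /\ B = adjoin A tau.

Definition semi_commutative_galois_extension (N : nat) A tau B : Prop :=
  galois_extension N A tau B /\ left_module A tau = right_module A tau.

End GaloisExtension.

Section TwoSidedIdeal.
Context {A : pzRingType}.

Record two_sided_ideal (I : set A) : Prop := TwoSidedIdeal {
  ideal0 : I 0;
  idealB : forall u v, I u -> I v -> I (u - v);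
  idealMl : forall a u, I u -> I (a * u);
  idealMr : forall a u, I u -> I (u * a)
}.

Definition ideal_gen (G : set A) : set A := smallest two_sided_ideal G.

Lemma ideal_genP (G : set A) : two_sided_ideal (ideal_gen G).
Proof.
split.
- by move=> I [II _]; exact: ideal0.
- by move=> u v Iu Iv I HI; apply: (idealB HI.1); [exact: Iu|exact: Iv].
- by move=> a u Iu I HI; apply: (idealMl HI.1); exact: Iu.
- by move=> a u Iu I HI; apply: (idealMr HI.1); exact: Iu.
Qed.

End TwoSidedIdeal.

(* The free unital associative K-algebra on two letters x (false), y (true). *)
Notation free_alg2 K := {malg K[{fmonom bool}]}.

(* The locks below keep unification from unfolding products of generators,
   which takes minutes. *)
HB.lock Definition free_x (K : fieldType) : free_alg2 K := mkmalgU (fmu false) 1.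
HB.lock Definition free_y (K : fieldType) : free_alg2 K := mkmalgU (fmu true) 1.

Section Relations.
Variables (K : fieldType) (N : nat) (q : K).

Local Notation free_x := (free_x K).
Local Notation free_y := (free_y K).

Definition rqplane_relations : set (free_alg2 K) :=
  [set free_x * free_y - q *: (free_y * free_x);
       free_x ^+ N - 1;
       free_y ^+ N - 1].

Definition rqplane_ideal : set (free_alg2 K) := ideal_gen rqplane_relations.

Definition rqplane_ideal_pred : {pred free_alg2 K} :=
  fun u => `[< rqplane_ideal u >].

Lemma rqplane_ideal_predP (u : free_alg2 K) :
  reflect (rqplane_ideal u) (u \in rqplane_ideal_pred).
Proof. exact: asboolP. Qed.

Lemma rqplane_ideal_zmod : zmod_closed rqplane_ideal_pred.
Proof.
have I := ideal_genP rqplane_relations.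
split; first by apply/rqplane_ideal_predP; exact: ideal0 I.
move=> u v /rqplane_ideal_predP Iu /rqplane_ideal_predP Iv.
by apply/rqplane_ideal_predP; exact: (idealB I).
Qed.

HB.instance Definition _ :=
  GRing.isZmodClosed.Build (free_alg2 K) rqplane_ideal_pred rqplane_ideal_zmod.

Lemma rqplane_idealMl (a u : free_alg2 K) :
  u \in rqplane_ideal_pred -> a * u \in rqplane_ideal_pred.
Proof.
move=> /rqplane_ideal_predP Iu; apply/rqplane_ideal_predP.
exact: (idealMl (ideal_genP _)).
Qed.

Lemma rqplane_idealMr (a u : free_alg2 K) :
  u \in rqplane_ideal_pred -> u * a \in rqplane_ideal_pred.
Proof.
move=> /rqplane_ideal_predP Iu; apply/rqplane_ideal_predP.
exact: (idealMr (ideal_genP _)).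
Qed.

Lemma rqplane_idealZ (c : K) (u : free_alg2 K) :
  u \in rqplane_ideal_pred -> c *: u \in rqplane_ideal_pred.
Proof. by move=> Iu; rewrite -mul_malgC; exact: rqplane_idealMl. Qed.

Lemma free_scalerAr (c : K) (u v : free_alg2 K) : c *: (u * v) = u * (c *: v).
Proof.
rewrite -[LHS]mul_malgC -[c *: v]mul_malgC [LHS]mulrA [RHS]mulrA.
suff -> : c%:MP * u = u * c%:MP by [].
have -> : u * c%:MP = \sum_(k <- msupp u) mkmalgU k (u@_k * c).
  rewrite malgM_def fgmulgU; apply: eq_bigr => k _.
  by rewrite mulm1.
rewrite malgM_def fgmulUg; apply: eq_bigr => k _.
by rewrite mul1m mulrC.
Qed.

End Relations.

(* Evaluation of the free algebra at two n.+1 x n.+1 matrices. *)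
Section MatrixEvaluation.
Variables (K : fieldType) (n : nat) (X Y : 'M[K]_n.+1).

Definition mon_eval (m : {fmonom bool}) : 'M[K]_n.+1 :=
  \prod_(b <- (m : seq bool)) if b then Y else X.

Lemma mon_eval_mmorphism : mmorphism mon_eval.
Proof.
split; last by rewrite /mon_eval fm1 big_nil.
by move=> m1 m2; rewrite /mon_eval fmM big_cat.
Qed.

HB.instance Definition _ := isMultiplicative.Build {fmonom bool} 'M[K]_n.+1
  mon_eval mon_eval_mmorphism.

Definition mx_eval : free_alg2 K -> 'M[K]_n.+1 :=
  mmap (@scalar_mx K n.+1) mon_eval.

Lemma mx_eval_monoid : monoid_morphism mx_eval.
Proof.
rewrite /mx_eval; split; first by rewrite mmap1.
apply: (fun H => (@commr_mmap_is_multiplicative _ _ _ (@scalar_mx K n.+1)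
  mon_eval H).1) => g m m'.
exact/esym/(@scalar_mxC K n.+1 n.+1).
Qed.

HB.instance Definition _ := GRing.Additive.copy mx_eval
  (mmap (@scalar_mx K n.+1) mon_eval).
HB.instance Definition _ :=
  GRing.isMonoidMorphism.Build (free_alg2 K) 'M[K]_n.+1 mx_eval mx_eval_monoid.

Lemma mx_evalB (u v : free_alg2 K) : mx_eval (u - v) = mx_eval u - mx_eval v.
Proof. exact: raddfB. Qed.

Lemma mx_evalM (u v : free_alg2 K) : mx_eval (u * v) = mx_eval u * mx_eval v.
Proof. exact: rmorphM. Qed.

Lemma mx_evalXn (u : free_alg2 K) k : mx_eval (u ^+ k) = mx_eval u ^+ k.
Proof. exact: rmorphXn. Qed.

Lemma mx_eval1 : mx_eval 1 = 1.
Proof. exact: rmorph1. Qed.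

Lemma mx_evalZ c u : mx_eval (c *: u) = c *: mx_eval u.
Proof. by rewrite /mx_eval mmapZ /= -mul_scalar_mx. Qed.

Lemma mx_eval_x : mx_eval (free_x K) = X.
Proof.
by rewrite /mx_eval free_x.unlock mmapU /= /mon_eval fmU big_seq1 mul1r.
Qed.

Lemma mx_eval_y : mx_eval (free_y K) = Y.
Proof.
by rewrite /mx_eval free_y.unlock mmapU /= /mon_eval fmU big_seq1 mul1r.
Qed.

Lemma mx_eval_ideal (N : nat) (q : K) (u : free_alg2 K) :
  X * Y = q *: (Y * X) -> X ^+ N = 1 -> Y ^+ N = 1 ->
  rqplane_ideal N q u -> mx_eval u = 0.
Proof.
move=> XY XN YN Iu.
have := Iu [set v | mx_eval v = 0]; apply; split.
  split => /=; first exact: raddf0.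
  - by move=> v w v0 w0; rewrite mx_evalB v0 w0 subrr.
  - by move=> a v v0; rewrite mx_evalM v0 mulr0.
  - by move=> a v v0; rewrite mx_evalM v0 mul0r.
move=> v [[|]|] /= ->.
- rewrite mx_evalB mx_evalZ; apply/eqP; rewrite subr_eq0; apply/eqP.
  rewrite [LHS]mx_evalM [X in _ = _ *: X]mx_evalM.
  by rewrite mx_eval_x mx_eval_y XY.
- by rewrite mx_evalB mx_evalXn mx_eval1 mx_eval_x XN subrr.
- by rewrite mx_evalB mx_evalXn mx_eval1 mx_eval_y YN subrr.
Qed.

End MatrixEvaluation.

Section ClockShift.
Variables (K : fieldType) (n : nat) (q : K).

Definition clock_mx : 'M[K]_n.+1 := diag_mx (\row_i q ^+ i).

Definition shift_mx : 'M[K]_n.+1 := \matrix_(i, j) (i == j + Zp1)%:R.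

Hypothesis qn : q ^+ n.+1 = 1.

Lemma clock_shift : clock_mx * shift_mx = q *: (shift_mx * clock_mx).
Proof.
apply/matrixP => i j.
rewrite /clock_mx -!mulmxE mul_diag_mx mul_mx_diag !mxE.
case: eqP => [->|_]; last by rewrite mulr0 mul0r mulr0.
rewrite mulr1 mul1r -exprS /= -[RHS](expr_mod _ qn).
by rewrite modnDmr addn1.
Qed.

Lemma clock_exp : clock_mx ^+ n.+1 = 1.
Proof.
have E k : clock_mx ^+ k = diag_mx (\row_i q ^+ (i * k)).
  elim: k => [|k IH].
    by apply/matrixP => i j; rewrite expr0 !mxE muln0 expr0.
  rewrite exprS IH /clock_mx -mulmxE mulmx_diag.
  by congr diag_mx; apply/rowP => i; rewrite !mxE mulnS exprD.
by apply/matrixP => i j; rewrite E !mxE mulnC exprM qn expr1n.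
Qed.

Lemma shift_exp : shift_mx ^+ n.+1 = 1.
Proof.
have E k : shift_mx ^+ k = \matrix_(i, j) (i == j + Zp1 *+ k)%:R.
  elim: k => [|k IH].
    by apply/matrixP => i j; rewrite expr0 !mxE mulr0n addr0.
  apply/matrixP => i j; rewrite exprSr IH -mulmxE !mxE.
  rewrite (bigD1 (j + Zp1)) //= big1 => [|l lj]; rewrite !mxE.
    by rewrite eqxx mulr1 addr0 mulrSr addrAC addrA.
  by rewrite (negbTE lj) mulr0.
rewrite E; apply/matrixP => i j; rewrite !mxE.
suff -> : Zp1 *+ n.+1 = 0 :> 'I_n.+1 by rewrite addr0.
by apply/val_inj; rewrite Zp_mulrn /= modnMl.
Qed.

End ClockShift.

Lemma rqplane_ideal_proper (K : fieldType) (N : nat) (q : K) :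
  N.-primitive_root q -> 1 \notin rqplane_ideal_pred N q.
Proof.
move=> hq; apply/negP => /rqplane_ideal_predP.
move: (prim_order_gt0 hq) (prim_expr_order hq).
case: N {hq} => // n _ qn.
move=> /(mx_eval_ideal (clock_shift qn) (clock_exp qn) (shift_exp _ _)).
by rewrite rmorph1 => /eqP; rewrite oner_eq0.
Qed.

(* The quotient of the free algebra by the two-sided ideal generated by the
   relations. The proof argument is there because library algebras are
   nontrivial, and this presentation collapses unless q ^+ N = 1. *)
Definition rqplane (K : fieldType) (N : nat) (q : K)
    of N.-primitive_root q : Type :=
  Quotient.quot (rqplane_ideal_pred N q).

HB.instance Definition _ (K : fieldType) (N : nat) (q : K)
    (hq : N.-primitive_root q) :=
  GRing.Zmodule.copy (rqplane hq) (Quotient.quot (rqplane_ideal_pred N q)).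
HB.instance Definition _ (K : fieldType) (N : nat) (q : K)
    (hq : N.-primitive_root q) :=
  EqQuotient.copy (rqplane hq) (Quotient.quot (rqplane_ideal_pred N q)).

Definition rqplane_pi (K : fieldType) (N : nat) (q : K)
    (hq : N.-primitive_root q) (u : free_alg2 K) : rqplane hq :=
  \pi_(rqplane hq) u.

HB.lock Definition rqplane_mul (K : fieldType) (N : nat) (q : K)
    (hq : N.-primitive_root q) (u v : rqplane hq) : rqplane hq :=
  rqplane_pi hq (repr u * repr v).

HB.lock Definition rqplane_scale (K : fieldType) (N : nat) (q : K)
    (hq : N.-primitive_root q) (c : K) (u : rqplane hq) : rqplane hq :=
  rqplane_pi hq (c *: repr u).

Section ReducedQuantumPlane.
Variables (K : fieldType) (N : nat) (q : K) (hq : N.-primitive_root q).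

Local Notation Q := (rqplane hq).
Local Notation I := (rqplane_ideal_pred N q).
Local Notation rqplane_pi := (rqplane_pi hq).
Local Notation rqplane_mul := (@rqplane_mul K N q hq).
Local Notation rqplane_scale := (@rqplane_scale K N q hq).

Lemma rqplane_piE (u v : free_alg2 K) :
  (rqplane_pi u == rqplane_pi v) = (u - v \in I).
Proof. by rewrite (Quotient.idealrBE I). Qed.

Lemma rqplane_reprK (u : Q) : rqplane_pi (repr u) = u.
Proof. exact: reprK. Qed.

Lemma rqplane_pi_repr (u : free_alg2 K) : repr (rqplane_pi u) - u \in I.
Proof. by rewrite -rqplane_piE rqplane_reprK. Qed.

Lemma rqplane_piD : {morph rqplane_pi : u v / u + v}.
Proof. exact: (Quotient.pi_add I). Qed.

Definition rqplane_one : Q := rqplane_pi 1.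

Lemma rqplane_piM (u v : free_alg2 K) :
  rqplane_pi (u * v) = rqplane_mul (rqplane_pi u) (rqplane_pi v).
Proof.
apply/esym/eqP; rewrite rqplane_mul.unlock rqplane_piE.
set u' := repr _; set v' := repr _.
have -> : u' * v' - u * v = u' * (v' - v) + (u' - u) * v.
  by rewrite mulrBr mulrBl addrA subrK.
by apply: rpredD; [apply: rqplane_idealMl|apply: rqplane_idealMr];
  exact: rqplane_pi_repr.
Qed.

Lemma rqplane_piZ (c : K) (u : free_alg2 K) :
  rqplane_pi (c *: u) = rqplane_scale c (rqplane_pi u).
Proof.
apply/esym/eqP; rewrite rqplane_scale.unlock rqplane_piE -scalerBr.
by apply: rqplane_idealZ; exact: rqplane_pi_repr.
Qed.

Let piE := (rqplane_piM, rqplane_piZ, rqplane_piD).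

Lemma rqplane_ind (P : Q -> Prop) : (forall u, P (rqplane_pi u)) ->
  forall u, P u.
Proof. by move=> H u; rewrite -[u]rqplane_reprK. Qed.

Fact rqplane_mulA : associative rqplane_mul.
Proof.
move=> u v w; elim/rqplane_ind: u => u; elim/rqplane_ind: v => v.
by elim/rqplane_ind: w => w; rewrite -!piE mulrA.
Qed.

Fact rqplane_mul1r : left_id rqplane_one rqplane_mul.
Proof. by move=> u; elim/rqplane_ind: u => u; rewrite -piE mul1r. Qed.

Fact rqplane_mulr1 : right_id rqplane_one rqplane_mul.
Proof. by move=> u; elim/rqplane_ind: u => u; rewrite -piE mulr1. Qed.

Fact rqplane_mulDl : left_distributive rqplane_mul +%R.
Proof.
move=> u v w; elim/rqplane_ind: u => u; elim/rqplane_ind: v => v.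
by elim/rqplane_ind: w => w; rewrite -!piE mulrDl.
Qed.

Fact rqplane_mulDr : right_distributive rqplane_mul +%R.
Proof.
move=> u v w; elim/rqplane_ind: u => u; elim/rqplane_ind: v => v.
by elim/rqplane_ind: w => w; rewrite -!piE mulrDr.
Qed.

Fact rqplane_pi0 : rqplane_pi 0 = 0.
Proof. by apply: (addrI (rqplane_pi 0)); rewrite -piE !addr0. Qed.

Fact rqplane_1neq0 : rqplane_one != 0.
Proof. by rewrite -rqplane_pi0 rqplane_piE subr0 rqplane_ideal_proper. Qed.

HB.instance Definition _ := GRing.Zmodule_isNzRing.Build Q
  rqplane_mulA rqplane_mul1r rqplane_mulr1 rqplane_mulDl rqplane_mulDr
  rqplane_1neq0.

Fact rqplane_scaleA (a b : K) (u : Q) :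
  rqplane_scale a (rqplane_scale b u) = rqplane_scale (a * b) u.
Proof. by elim/rqplane_ind: u => u; rewrite -!piE scalerA. Qed.

Fact rqplane_scale1 : left_id 1 rqplane_scale.
Proof. by move=> u; elim/rqplane_ind: u => u; rewrite -piE scale1r. Qed.

Fact rqplane_scaleDr : right_distributive rqplane_scale +%R.
Proof.
move=> a u v; elim/rqplane_ind: u => u; elim/rqplane_ind: v => v.
by rewrite -!piE scalerDr.
Qed.

Fact rqplane_scaleDl (u : Q) : {morph rqplane_scale^~ u : a b / a + b}.
Proof. by move=> a b; elim/rqplane_ind: u => u; rewrite -!piE scalerDl. Qed.

HB.instance Definition _ := GRing.Zmodule_isLmodule.Build K Q
  rqplane_scaleA rqplane_scale1 rqplane_scaleDr rqplane_scaleDl.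

Fact rqplane_scaleAl (a : K) (u v : Q) : a *: (u * v) = (a *: u) * v.
Proof.
elim/rqplane_ind: u => u; elim/rqplane_ind: v => v.
by rewrite /GRing.scale /GRing.mul /= -!piE scalerAl.
Qed.

HB.instance Definition _ := GRing.Lmodule_isLalgebra.Build K Q rqplane_scaleAl.

Fact rqplane_scaleAr (a : K) (u v : Q) : a *: (u * v) = u * (a *: v).
Proof.
elim/rqplane_ind: u => u; elim/rqplane_ind: v => v.
by rewrite /GRing.scale /GRing.mul /= -!piE free_scalerAr.
Qed.

HB.instance Definition _ := GRing.Lalgebra_isAlgebra.Build K Q rqplane_scaleAr.

Definition rqplane_x : Q := rqplane_pi (free_x K).
Definition rqplane_y : Q := rqplane_pi (free_y K).

Definition rqplane0 : set Q := subalgebra_gen [set rqplane_x].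

End ReducedQuantumPlane.

Arguments rqplane0 {K N q} hq.

(* Main.v *)
Require Import Defs.
From mathcomp Require Import all_boot all_order all_algebra.
From mathcomp Require Import classical_sets reals complex.
From mathcomp.multinomials Require Import monalg.

(** The relation [x * y = q *: (y * x)] carries both nontrivial points.

    It moves [y] across a polynomial in [x] at the price of replacing [x] by
    [q *: x] or [q^-1 *: x], which stay in the subalgebra generated by [x]:
    this is the equality of the left and right modules, [rqplane_bimodule].

    It also shows that no power [y ^+ k] with [0 < k < N] is a polynomial in
    [x]. Such a polynomial commutes with [x] ([rqplane0_commx]), whereas
    [x * y ^+ k = q ^+ k *: (y ^+ k * x)] ([rqplane_xyk]). Hence
    [(q ^+ k - 1) *: (y ^+ k * x) = 0]; but [y ^+ k * x] is invertible because
    [x ^+ N = y ^+ N = 1], the algebra is not zero, and [q ^+ k != 1] because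
    [q] is primitive ([rqplane_ynotin]). That the relations do
    not collapse the algebra thus replaces the computation of a basis.

    Finally [x] and [y] generate the whole algebra, since monomials span the
    free algebra ([rqplane_generated]). *)

Set Implicit Arguments.
Unset Strict Implicit.
Unset Printing Implicit Defensive.

Import GRing.Theory.

Local Open Scope ring_scope.
Local Open Scope classical_set_scope.

(** * Generated subalgebras *)

Section GeneratedSubalgebra.
Context {K : fieldType} {At : algType K}.
Implicit Types (A G : set At) (tau : At).

Lemma is_subalgebraP A :
  is_subalgebra A <->
  [/\ A 1, forall (c : K) u v, A u -> A v -> A (c *: u + v)
    & forall u v, A u -> A v -> A (u * v)].
Proof.
split=> [[A1 AL AM]|[A1 AL AM]].
  split; first exact/set_mem.
  - by move=> c u v /mem_set Au /mem_set Av; exact/set_mem/AL.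
  - by move=> u v /mem_set Au /mem_set Av; exact/set_mem/AM.
split; first exact/mem_set.
- by move=> c u v /set_mem Au /set_mem Av; exact/mem_set/AL.
- by move=> u v /set_mem Au /set_mem Av; exact/mem_set/AM.
Qed.

Lemma subalgebraZ A (c : K) u : is_subalgebra A -> A u -> A (c *: u).
Proof.
move=> /is_subalgebraP[A1 AL _] Au; rewrite -[c *: u]addr0; apply: (AL) => //.
by rewrite -(addNr 1) -scaleN1r; exact: AL.
Qed.

Lemma subalgebra_genP G : is_subalgebra (subalgebra_gen G).
Proof.
apply/is_subalgebraP; split.
- by move=> A [/is_subalgebraP[]].
- move=> c u v Gu Gv A [sA GA].
  have [_ AL _] := (is_subalgebraP A).1 sA.
  by apply: AL; [exact: Gu|exact: Gv].
- move=> u v Gu Gv A [sA GA].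
  have [_ _ AM] := (is_subalgebraP A).1 sA.
  by apply: AM; [exact: Gu|exact: Gv].
Qed.

(** The elements [a] for which [a * tau] lies in [tau] times the generated
    subalgebra form a subalgebra, so commuting past [tau] need only be checked
    on the generators. *)
Lemma left_sub_right_module G tau :
  (forall g, G g -> exists2 b, subalgebra_gen G b & g * tau = tau * b) ->
  left_module (subalgebra_gen G) tau `<=` right_module (subalgebra_gen G) tau.
Proof.
move=> HG _ [a Ga <-].
have [G1 GL GM] := (is_subalgebraP _).1 (subalgebra_genP G).
suff [b Gb E] : exists2 b, subalgebra_gen G b & a * tau = tau * b.
  by exists b.
move: a Ga; apply: smallest_sub => //; apply/is_subalgebraP; split.
- by exists 1 => //; rewrite mul1r mulr1.
- move=> c u v [b Gb Eb] [d Gd Ed]; exists (c *: b + d); first exact: GL.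
  by rewrite mulrDl mulrDr -scalerAl Eb Ed -scalerAr.
- move=> u v [b Gb Eb] [d Gd Ed]; exists (b * d); first exact: GM.
  by rewrite -mulrA Ed mulrA Eb mulrA.
Qed.

Lemma right_sub_left_module G tau :
  (forall g, G g -> exists2 a, subalgebra_gen G a & a * tau = tau * g) ->
  right_module (subalgebra_gen G) tau `<=` left_module (subalgebra_gen G) tau.
Proof.
move=> HG _ [b Gb <-].
have [G1 GL GM] := (is_subalgebraP _).1 (subalgebra_genP G).
suff [a Ga E] : exists2 a, subalgebra_gen G a & a * tau = tau * b.
  by exists a.
move: b Gb; apply: smallest_sub => //; apply/is_subalgebraP; split.
- by exists 1 => //; rewrite mul1r mulr1.
- move=> c u v [a Ga Ea] [d Gd Ed]; exists (c *: a + d); first exact: GL.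
  by rewrite mulrDl mulrDr -scalerAl Ea Ed -scalerAr.
- move=> u v [a Ga Ea] [d Gd Ed]; exists (a * d); first exact: GM.
  by rewrite -mulrA Ed mulrA Ea mulrA.
Qed.

End GeneratedSubalgebra.

(** * The reduced quantum plane *)

Section Plane.
Variables (K : fieldType) (N : nat) (q : K) (hq : N.-primitive_root q).

Local Notation Q := (rqplane hq).
Local Notation x := (rqplane_x hq).
Local Notation y := (rqplane_y hq).
Local Notation pi := (rqplane_pi hq).

(** The morphism laws of the projection, restated for the ring and algebra
    operations of the quotient, so that algebraic rewriting applies. *)
Lemma piM (u v : free_alg2 K) : pi (u * v) = pi u * pi v.
Proof. exact: rqplane_piM. Qed.

Lemma piZ (c : K) (u : free_alg2 K) : pi (c *: u) = c *: pi u.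
Proof. exact: rqplane_piZ. Qed.

Lemma pi1 : pi 1 = 1.
Proof. by []. Qed.

Lemma piXn (u : free_alg2 K) k : pi (u ^+ k) = pi u ^+ k.
Proof. by elim: k => [|k IH]; rewrite ?expr0 // !exprS piM IH. Qed.

Lemma pi_relation (u v : free_alg2 K) :
  rqplane_relations N q (u - v) -> pi u = pi v.
Proof.
move=> H; apply/eqP; rewrite rqplane_piE; apply/rqplane_ideal_predP.
by move=> I [_]; apply.
Qed.

Lemma rqplane_xy : x * y = q *: (y * x).
Proof.
by rewrite -!piM -piZ; apply: pi_relation; left; left.
Qed.

Lemma rqplane_xN : x ^+ N = 1.
Proof. by rewrite -piXn -pi1; apply: pi_relation; left; right. Qed.

Lemma rqplane_yN : y ^+ N = 1.
Proof. by rewrite -piXn -pi1; apply: pi_relation; right. Qed.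

Lemma mkmalgUE (m : {fmonom bool}) (c : K) : mkmalgU m c = c *: mkmalgU m 1.
Proof. by rewrite -mul_malgC malgM_def fgmulUU mulr1 mul1m. Qed.

(** By induction on words, the class of every monomial of the free algebra lies
    in [A]; these classes span. *)
Lemma rqplane_generated A : is_subalgebra A -> A x -> A y -> A = [set: Q].
Proof.
move=> sA Ax Ay; have /is_subalgebraP[A1 AL AM] := sA.
apply/seteqP; split=> // v _.
elim/rqplane_ind: v => u.
have A0 : A 0 by have := AL (-1) 1 1 A1 A1; rewrite scaleN1r addNr.
have AM1 (m : {fmonom bool}) : A (pi (mkmalgU m 1)).
  case: m => s; elim: s => [|b s IH].
    have -> // : FMonom [::] = mone :> {fmonom bool}.
      by apply/val_inj; rewrite /= fm1.
  have -> : mkmalgU (FMonom (b :: s)) 1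
      = (if b then free_y K else free_x K) * mkmalgU (FMonom s) 1.
    have -> : FMonom (b :: s) = mmul (fmu b) (FMonom s).
      by apply/val_inj; rewrite /= fmM fmU.
    rewrite free_x.unlock free_y.unlock.
    by case: b; rewrite malgM_def fgmulUU mulr1.
  by rewrite piM; apply: AM => //; case: (b).
have AMc m c : A (pi (mkmalgU m c)).
  by rewrite mkmalgUE piZ; exact: subalgebraZ.
rewrite [u]monalgE; elim: (X in \sum_(k <- X) _) => [|m s IH].
  by rewrite big_nil rqplane_pi0.
rewrite big_cons rqplane_piD -[pi (mkmalgU _ _)]scale1r.
exact: (AL _ _ _ (AMc m _) IH).
Qed.

Lemma rqplane_xA0 : rqplane0 hq x.
Proof. by move=> A [_]; apply. Qed.

(** On the generator, the two inclusions are [x * y = y * (q *: x)] and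
    [(q^-1 *: x) * y = y * x]. *)
Lemma rqplane_bimodule :
  left_module (rqplane0 hq) y = right_module (rqplane0 hq) y.
Proof.
have AZ c : rqplane0 hq (c *: x).
  exact: subalgebraZ (subalgebra_genP _) rqplane_xA0.
apply/seteqP; split.
  apply: left_sub_right_module => _ ->; exists (q *: x); first exact: AZ.
  by rewrite rqplane_xy scalerAr.
apply: right_sub_left_module => _ ->; exists (q^-1 *: x); first exact: AZ.
have q0 : q != 0 by rewrite (prim_root_eq0 hq) -lt0n (prim_order_gt0 hq).
by rewrite -scalerAl rqplane_xy scalerA mulVf // scale1r.
Qed.

Lemma rqplane_xyk k : x * y ^+ k = q ^+ k *: (y ^+ k * x).
Proof.
elim: k => [|k IH]; first by rewrite !expr0 scale1r mulr1 mul1r.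
rewrite exprSr mulrA IH -scalerAl -[_ * x * y]mulrA rqplane_xy.
by rewrite -scalerAr scalerA mulrA -!exprSr.
Qed.

(** The centralizer of [x] is a subalgebra containing [x]. *)
Lemma rqplane0_commx a : rqplane0 hq a -> x * a = a * x.
Proof.
move: a; apply: smallest_sub => [|_ ->//]; apply/is_subalgebraP; split => /=.
- by rewrite mulr1 mul1r.
- by move=> c u v Eu Ev; rewrite mulrDr mulrDl -scalerAr -scalerAl Eu Ev.
- by move=> u v Eu Ev; rewrite mulrA Eu -mulrA Ev mulrA.
Qed.

(** Otherwise [y ^+ k] commutes with [x]; together with [rqplane_xyk] this makes
    [y ^+ k * x] vanish unless [q ^+ k = 1]. *)
Lemma rqplane_ynotin k : (1 <= k <= N - 1)%N -> ~ rqplane0 hq (y ^+ k).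
Proof.
move=> /andP[k0 kN] /rqplane0_commx xyk.
have N0 := prim_order_gt0 hq.
have kltN : (k < N)%N by rewrite -(subnK N0) addn1 ltnS.
have /eqP : (q ^+ k - 1) *: (y ^+ k * x) = 0.
  by rewrite scalerBl scale1r -rqplane_xyk xyk subrr.
rewrite scaler_eq0 subr_eq0 => /orP[qk1|/eqP yx0].
  by move: qk1; rewrite -(prim_order_dvd hq) gtnNdvd.
(* [y ^+ k * x] is a unit, with inverse [x ^+ N.-1 * y ^+ (N - k)]. *)
have : y ^+ (N - k) * (y ^+ k * x) * x ^+ N.-1 = 1.
  by rewrite mulrA -exprD subnK ?(ltnW kltN) // rqplane_yN mul1r -exprS
    prednK // rqplane_xN.
by rewrite yx0 mulr0 mul0r => /esym/eqP; rewrite oner_eq0.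
Qed.

Lemma rqplane_adjoin : [set: Q] = adjoin (rqplane0 hq) y.
Proof.
apply/esym/rqplane_generated; first exact: subalgebra_genP.
  by move=> A [_]; apply; left; exact: rqplane_xA0.
by move=> A [_]; apply; right.
Qed.

End Plane.

Theorem mainTheorem2 (R : realType) (N : nat) (q : R[i])
  (hN : (2 <= N)%N) (hq : N.-primitive_root q) :
  semi_commutative_galois_extension N
    (rqplane0 hq) (rqplane_y hq) [set: rqplane hq]%classic.
Proof.
split; last exact: rqplane_bimodule.
split; last exact: rqplane_adjoin.
split => //; first exact: subalgebra_genP.
  by left; exact: rqplane_yN.
exact: rqplane_ynotin.
Qed.
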